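(* Let $w$ be a Sturmian word and let $v$ be a factor of $w$. Then $v$ has exactly two abelian returns in $w$ if and only if $v$ is singular.
   Context: A factor of an infinite word $w=w_1w_2\cdots$ is a finite word occurring as a block of consecutive letters of $w$. A Sturmian word is a right-infinite word having exactly $n+1$ distinct factors of length $n$ for every $n\ge 0$ (so it is a binary word; its letters are denoted $0,1$). Sturmian words are recurrent, i.e. each factor occurs infinitely many times. For a finite word $u$ and a letter $a$, $|u|$ is the length of $u$ and $|u|_a$ the number of occurrences of $a$ in $u$. Two finite words $u,v$ are abelian equivalent, $u\sim_{ab}v$, if $|u|_a=|v|_a$ for all letters $a$. A factor $v$ of a Sturmian word $w$ is singular if it is the only factor of $w$ in its abelian class, i.e. every factor $v'$ of $w$ with $v'\sim_{ab}v$ equals $v$. Abelian returns: let $w$ be a recurrent infinite word, $u$ a factor of $w$, and let $n_1<n_2<n_3<\cdots$ be all the integers $n_i$ such that $w_{n_i}\cdots w_{n_i+|u|-1}\sim_{ab}u$. An abelian return to $u$ in $w$ is the abelian equivalence class of a word $w_{n_i}\cdots w_{n_{i+1}-1}$, $i\ge1$. The number of abelian returns to $u$ is the number of distinct such abelian classes. *)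

(* Defs.v *)
From mathcomp Require Import all_boot.
From mathcomp Require Import mathcomp_extra boolp classical_sets functions cardinality.

Set Implicit Arguments.
Unset Strict Implicit.
Unset Printing Implicit Defensive.

Local Open Scope classical_set_scope.
Local Open Scope card_scope.

(* Infinite words are functions from nat, indexed from 0: the letter usually
   written w_1 is [w 0]. *)
Definition infword (A : Type) := nat -> A.

(* [block w i n] is the block of [n] letters [w i ... w (i + n - 1)]. *)
Definition block (A : Type) (w : infword A) (i n : nat) : seq A :=
  mkseq (fun k => w (i + k)) n.

Definition factor (A : Type) (w : infword A) (u : seq A) : Prop :=
  exists i, block w i (size u) = u.

Definition sturmian (A : Type) (w : infword A) : Prop :=
  forall n, [set u | factor w u /\ size u = n] #= `I_n.+1.

Definition abelian_equiv (A : eqType) (u v : seq A) : Prop :=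
  forall a, count_mem a u = count_mem a v.

Definition abelian_class (A : eqType) (u : seq A) : set (seq A) :=
  [set v | abelian_equiv u v].

Definition singular (A : eqType) (w : infword A) (v : seq A) : Prop :=
  factor w v /\
  forall v', factor w v' -> abelian_equiv v' v -> v' = v.

Definition abelian_occ (A : eqType) (w : infword A) (u : seq A) (i : nat) :
    Prop :=
  abelian_equiv (block w i (size u)) u.

Definition consecutive_occ (A : eqType) (w : infword A) (u : seq A)
    (i j : nat) : Prop :=
  [/\ i < j, abelian_occ w u i, abelian_occ w u j &
      forall k, i < k < j -> ~ abelian_occ w u k].

Definition abelian_returns (A : eqType) (w : infword A) (u : seq A) :
    set (set (seq A)) :=
  [set C | exists i j,
     consecutive_occ w u i j /\ C = abelian_class (block w i (j - i))].

(* Main.v *)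
Require Import Defs.
From mathcomp Require Import all_boot finmap zify.
From mathcomp Require Import mathcomp_extra boolp classical_sets functions cardinality.

(* Let [weight n i] be the number of occurrences of a fixed letter in the block
   of length [n] starting at [i].  By balance it takes two values, and the letter
   can be chosen so that [v] is light, i.e. of minimal weight; its abelian
   occurrences are then the light positions.  Ordering positions by
   [forall k, weight k x <= weight k y] plays the role of the order on the circle
   of the rotation coding [w]: it is total, the light positions form an initial
   segment J, and moving from [x] to [x + q] goes up or down according to whether
   the block of length [q] at [x] is light or heavy.  Let [q1] and [q2] be the
   least lengths of an upward and of a downward move from J to J.  Both give
   abelian returns, and they are different; there is a third one exactly when some
   point of J admits neither move.  In terms of a rotation by [alpha], J has length
   the distance from [n * alpha] to the next integer, and the absence of a third
   return means that [q2 = q1 + n], i.e. that no [- k * alpha] with [0 < k < n] cuts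
   J, i.e. that J corresponds to a single factor. *)

Set Implicit Arguments.
Unset Strict Implicit.
Unset Printing Implicit Defensive.

Local Open Scope classical_set_scope.
Local Open Scope card_scope.

(** * Blocks and factors of infinite words *)

Section Blocks.
Context {A : Type}.
Implicit Types (w : infword A) (i j m n : nat).

Lemma size_block w i n : size (block w i n) = n.
Proof. exact: size_mkseq. Qed.

Lemma nth_block x0 w i n k : k < n -> nth x0 (block w i n) k = w (i + k).
Proof. exact: nth_mkseq. Qed.

Lemma blockS w i n : block w i n.+1 = w i :: block w i.+1 n.
Proof.
rewrite /block /mkseq /= addn0 (iotaDl 1 0) -map_comp; congr (_ :: _).
by apply: eq_map => k /=; rewrite addnS.
Qed.

Lemma block_rcons w i n : block w i n.+1 = rcons (block w i n) (w (i + n)).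
Proof. by rewrite /block mkseqS. Qed.

Lemma block_cat w i m n : block w i (m + n) = block w i m ++ block w (i + m) n.
Proof.
elim: m i => [|m IHm] i; first by rewrite addn0.
by rewrite addSn !blockS IHm /= addSnnS.
Qed.

Lemma eq_block w i j n :
  (forall k, k < n -> w (i + k) = w (j + k)) -> block w i n = block w j n.
Proof.
move=> eqw; apply: (@eq_from_nth _ (w i)); rewrite !size_block // => k kn.
by rewrite !nth_block // eqw.
Qed.

Lemma factor_block w i n : factor w (block w i n).
Proof. by exists i; rewrite size_block. Qed.

Lemma factorP w u : factor w u -> exists i, u = block w i (size u).
Proof. by case=> i <-; exists i; rewrite size_block. Qed.

Lemma factor_behead w b u : factor w (b :: u) -> factor w u.
Proof. by case=> i; rewrite /= blockS => -[_ <-]; exact: factor_block. Qed.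

End Blocks.

(** * Aperiodicity and right special factors of Sturmian words *)

Section Sturmian.
Variable w : infword bool.
Hypothesis hw : sturmian w.

Lemma sturmian_enum m : exists s : seq (seq bool),
  [/\ uniq s, size s = m.+1 & forall u, u \in s <-> factor w u /\ size u = m].
Proof.
have hm := hw m; have /finite_setP/finite_fsetP[X defX] : exists n,
    [set u | factor w u /\ size u = m] #= `I_n by exists m.+1.
move: hm; rewrite defX => /card_eq_fsetP size_X.
exists (enum_fset X); split; [exact: fset_uniq | by [] | move=> u].
by have -> : (factor w u /\ size u = m) = (u \in X) by rewrite -[RHS]/([set` X] u) -defX.
Qed.

(** Under such a period every factor of length [N + q] would already start before position [N + q],
    one factor too few. *)
Lemma sturmian_not_eventually_periodic N q :
  0 < q -> ~ (forall x, N <= x -> w (x + q) = w x).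
Proof.
move=> q0 per; have [s [us ss memP]] := sturmian_enum (N + q).
suff : {subset s <= map (fun i => block w i (N + q)) (iota 0 (N + q))}.
  by move/(uniq_leq_size us); rewrite ss size_map size_iota ltnn.
move=> u /memP[[i eq_u] su]; rewrite -eq_u su {s us ss memP eq_u su}.
elim/ltn_ind: i => i IH; case: (ltnP i (N + q)) => iNq.
  by apply/mapP; exists i; rewrite ?mem_iota.
have -> : block w i (N + q) = block w (i - q) (N + q).
  apply: eq_block => k _; have -> : i + k = i - q + k + q by lia.
  by apply: per; lia.
by apply: IH; lia.
Qed.

Definition right_special (u : seq bool) : Prop :=
  forall b, factor w (rcons u b).

Lemma right_special_behead b u : right_special (b :: u) -> right_special u.
Proof. by move=> rsu c; apply: (@factor_behead _ _ b); exact: rsu. Qed.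

(** Each of the [m + 1] factors of length [m] has an extension; two right special ones would
    contribute a second extension each, giving [m + 3] factors of length [m + 1]. *)
Lemma right_special_unique u u' :
  right_special u -> right_special u' -> size u = size u' -> u = u'.
Proof.
move=> rsu rsu' eq_size; apply: contrapT => /eqP neq_uu'.
have [s [us ss memP]] := sturmian_enum (size u).
have [s' [us' ss' memP']] := sturmian_enum (size u).+1.
pose e v := `[< factor w (rcons v true) >].
pose T := rcons u (~~ e u) :: rcons u' (~~ e u') :: [seq rcons v (e v) | v <- s].
have uT : uniq T.
  rewrite /= inE negb_or eqseq_rcons (negPf neq_uu') /=.
  rewrite map_inj_uniq ?us ?andbT; last by move=> v v' /rcons_inj[].
  by apply/andP; split; apply/mapP => -[v _ /rcons_inj[->]]; case: (e v).
suff : {subset T <= s'}.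
  by move/(uniq_leq_size uT); rewrite /= size_map ss ss'; lia.
move=> z; rewrite !inE => /or3P[/eqP-> | /eqP-> | /mapP[v /memP[fv sv] ->]];
  apply/memP'; rewrite size_rcons -?eq_size ?sv; split => //.
rewrite /e; case: asboolP => [//|nfv]; move: fv => /factorP[i eq_v].
move: nfv (factor_block w i (size v).+1); rewrite block_rcons -eq_v.
by case: (w _).
Qed.

(* The window of length [2 (size p).+1] starting at [c p c] contains no
   right special factor of length [(size p).+1], hence two equal ones, and from
   there on the word is periodic. *)
Lemma sturmian_no_conservative_extension c p :
  rev p = p -> factor w (c :: rcons p c) -> right_special p ->
  factor w (~~ c :: p) -> ~ right_special (c :: p) -> False.
Proof.
move=> pal fcpc rsp fncp nrs; set m := (size p).+1.
have [z eq_z] : exists z, block w z m.+1 = c :: rcons p c.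
  by have [z eq_z] := factorP fcpc; exists z; rewrite eq_z /= size_rcons.
(* At [i = size p] the default value [c] of [nth] is the last letter of [c p c]. *)
have wz i : i < m -> w (z + i.+1) = nth c p i.
  move=> im; rewrite -(@nth_block _ c w z m.+1) ?eq_z //= nth_rcons.
  by rewrite if_same; case: ltnP => // pi; rewrite nth_default.
have not_ncp j : j <= m -> block w (z + j) m <> ~~ c :: p.
  case: j => [|j] jm eq_b.
    move: eq_z; rewrite -addn1 block_cat -[z in block w z m]addn0 eq_b /= => -[].
    by case: (c).
  have hd : w (z + j.+1) = ~~ c by move: eq_b; rewrite blockS => -[].
  have jp : j < size p.
    rewrite ltn_neqAle -ltnS jm andbT; apply/eqP => jE.
    by move: hd; rewrite wz // nth_default ?jE //; case: (c).
  (* In an occurrence of [~~ c :: p] at [z + j.+1], the final [c] of [c p c] would be the letter of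
     [p] mirror to index [j], which is [~~ c] since [p] is a palindrome. *)
  have := @nth_block _ c w (z + j.+1) m (m - j.+1).
  rewrite eq_b => /(_ ltac:(lia)).
  have -> : m - j.+1 = (size p - j.+1).+1 by rewrite /m; lia.
  have -> : z + j.+1 + (size p - j.+1).+1 = z + (size p).+1 by lia.
  rewrite wz // [nth _ _ (size p)]nth_default //= -nth_rev // pal -wz // hd.
  by case: (c).
have nrs_window j : j <= m -> ~ right_special (block w (z + j) m).
  move=> jm rs; move: (rs); rewrite blockS => /right_special_behead rs'.
  have eq_p := right_special_unique rs' rsp (size_block _ _ _).
  move: rs (not_ncp j jm); rewrite blockS eq_p.
  by case: (w (z + j)) (c) nrs => -[].
have [s [us ss memP]] := sturmian_enum m.
pose T := [seq block w (z + j) m | j <- iota 0 m.+1].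
(* Pigeonhole: with [~~ c :: p], the [m + 1] blocks of the window would make [m + 2] factors of
   length [m]. *)
have [i [j [ij jm eq_ij]]] : exists i j,
    [/\ i < j, j <= m & block w (z + i) m = block w (z + j) m].
  apply: contrapT => no_eq.
  have uT : uniq ((~~ c :: p) :: T).
    rewrite cons_uniq map_inj_in_uniq ?iota_uniq ?andbT; last first.
      move=> i j; rewrite !mem_iota => im jm eq_ij.
      by case: (ltngtP i j) => // ij; case: no_eq;
        [exists i, j | exists j, i]; split => //; lia.
    apply/mapP => -[j]; rewrite mem_iota => jm eq_b.
    by apply: (not_ncp j); rewrite ?eq_b //; lia.
  suff : {subset (~~ c :: p) :: T <= s}.
    by move/(uniq_leq_size uT); rewrite /= ss size_map size_iota; lia.
  move=> u; rewrite inE => /orP[/eqP->|/mapP[j _ ->]]; apply/memP.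
    by [].
  by rewrite size_block; split=> //; exact: factor_block.
(* Every block met from here on already occurs in the window, so it is not right special and
   determines the next letter. *)
have per t : block w (z + i + t) m = block w (z + j + t) m /\
    exists2 r, r <= m & block w (z + j + t) m = block w (z + r) m.
  elim/ltn_ind: t => -[|t] IH; first by rewrite !addn0; split=> //; exists j.
  have [eq_t [r rm eq_r]] := IH t (ltnSn t).
  have step : block w (z + i + t.+1) m = block w (z + j + t.+1) m.
    have eq_next : w (z + i + t + m) = w (z + j + t + m).
      apply: contrapT => /eqP neq; apply: (nrs_window r rm); rewrite -eq_r => b.
      have := factor_block w (z + i + t) m.+1.
      have := factor_block w (z + j + t) m.+1.
      rewrite !(block_rcons _ _ m) eq_t; move: neq.
      by case: (w (z + i + t + m)) (w (z + j + t + m)) b => -[] [].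
    have : block w (z + i + t) m.+1 = block w (z + j + t) m.+1.
      by rewrite !(block_rcons _ _ m) eq_t eq_next.
    by rewrite !(blockS _ _ m) !addnS => /(congr1 behead).
  split=> //; rewrite -step; case: (ltnP (i + t.+1) j) => h.
    by exists (i + t.+1); [lia | rewrite addnA].
  have [|_ [r' r'm eq_r']] := IH (i + t.+1 - j); first by lia.
  by exists r' => //; rewrite -eq_r'; congr block; lia.
apply: (@sturmian_not_eventually_periodic (z + i) (j - i)); first by lia.
move=> x ix; have [+ _] := per (x - (z + i)).
have -> : z + i + (x - (z + i)) = x by lia.
have -> : z + j + (x - (z + i)) = x + (j - i) by lia.
by rewrite /m !blockS => -[].
Qed.

End Sturmian.

(** * Letter counts and balance of Sturmian words *)

Section Weight.
Variables (w : infword bool) (a : bool).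

Definition weight (n i : nat) : nat := count_mem a (block w i n).

Lemma weightD m n i : weight (m + n) i = weight m i + weight n (i + m).
Proof. by rewrite /weight block_cat count_cat. Qed.

Lemma weight1 i : weight 1 i = (w i == a).
Proof. by rewrite /weight /block /= addn0 addn0. Qed.

Lemma weightS n i : weight n.+1 i = (w i == a) + weight n i.+1.
Proof. by rewrite -add1n weightD weight1 addn1. Qed.

Lemma weightSr n i : weight n.+1 i = weight n i + (w (i + n) == a).
Proof. by rewrite -addn1 weightD weight1. Qed.

(* A shortest pair of unbalanced blocks has the form [b p b], [a p a] with
   [b != a] and [p] a palindrome. *)
Lemma sturmian_balanced n x y : sturmian w -> weight n y <= (weight n x).+1.
Proof.
move=> hw; elim/ltn_ind: n x y => n IH x y; rewrite leqNgt; apply/negP => unb.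
case: n => [|[|m]] in IH unb *; first by [].
  by move: unb; rewrite !weight1; case: (_ == a); case: (_ == a).
have mid k : 0 < k < m.+2 -> weight k y = (weight k x).+1.
  move=> km; have := IH k ltac:(lia) x y.
  have := IH (m.+2 - k) ltac:(lia) (x + k) (y + k); move: unb.
  have -> : weight m.+2 x = weight k x + weight (m.+2 - k) (x + k).
    by rewrite -weightD; congr weight; lia.
  have -> : weight m.+2 y = weight k y + weight (m.+2 - k) (y + k).
    by rewrite -weightD; congr weight; lia.
  by lia.
have eq_bool (b c : bool) : (b == a) = (c == a) -> b = c by case: a b c => -[] [].
have wx : w x = ~~ a.
  by move: (mid 1 isT); rewrite !weight1; case: (w x) (w y) (a) => -[] [].
have wy : w y = a.
  by move: (mid 1 isT); rewrite !weight1; case: (w x) (w y) (a) => -[] [].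
have wxm : w (x + m.+1) = ~~ a.
  move: unb (mid m.+1 ltac:(lia)); rewrite !(weightSr m.+1).
  by case: (w (x + _)) (a) => -[] //=; lia.
have wym : w (y + m.+1) = a.
  move: unb (mid m.+1 ltac:(lia)); rewrite !(weightSr m.+1).
  by case: (w (y + _)) (a) => -[] //=; lia.
have eq_w k : k < m -> w (x.+1 + k) = w (y.+1 + k).
  move=> km; apply: eq_bool; rewrite !addSnnS.
  move: (mid k.+1 ltac:(lia)) (mid k.+2 ltac:(lia)).
  by rewrite !(weightSr k.+1); lia.
(* Balance in length [k.+1] is applied twice: prefix of one block against suffix of the other, and
   conversely. *)
have prefix_suffix k : k <= m -> weight k x.+1 = weight k (x + (m.+1 - k)).
  move=> km; have := IH k.+1 ltac:(lia) (x + (m.+1 - k)) y.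
  have := IH k.+1 ltac:(lia) x (y + (m.+1 - k)); have := mid k.+1 ltac:(lia).
  have := mid (m.+1 - k) ltac:(lia); have := mid m.+1 ltac:(lia).
  have eq_m : m.+1 = m.+1 - k + k by lia.
  rewrite {1 2}eq_m !weightD !(weightS k x) !(weightS k y) !(weightSr k).
  rewrite -!addnA -eq_m wx wy wxm wym eqxx; case: (a) => /=; lia.
pose p := block w x.+1 m.
have def_p : block w y.+1 m = p by apply: eq_block => k /eq_w.
have pal : rev p = p.
  apply: (@eq_from_nth _ a); rewrite size_rev size_block // => i im.
  rewrite nth_rev ?size_block // !nth_block //; last by lia.
  apply: eq_bool; have := prefix_suffix i ltac:(lia).
  have := prefix_suffix i.+1 ltac:(lia).
  rewrite (weightSr i x.+1) weightS.
  have -> : (x + (m.+1 - i.+1)).+1 = x + (m.+1 - i) by lia.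
  have -> : x + (m.+1 - i.+1) = x.+1 + (m - i.+1) by lia.
  by lia.
have fx : factor w (~~ a :: rcons p (~~ a)).
  by rewrite -{1}wx -wxm addnS -addSn -block_rcons -blockS; exact: factor_block.
have fy : factor w (a :: rcons p a).
  rewrite -def_p -{1}wy -wym addnS -addSn -block_rcons -blockS.
  exact: factor_block.
have rsp : right_special w p.
  by move: (factor_behead fx) (factor_behead fy); case: (a) => fF fT [].
(* At most one of [a p] and [~~ a p] is right special; [c] is chosen so that [c p] is not. *)
case: (EM (right_special w (a :: p))) => rs.
  apply: (sturmian_no_conservative_extension hw pal fx rsp); rewrite ?negbK.
    by rewrite -def_p -wy -blockS; exact: factor_block.
  move=> /(right_special_unique hw rs) /(_ erefl) [].
  by case: (a).
apply: (sturmian_no_conservative_extension hw pal fy rsp _ rs).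
by rewrite -wx -blockS; exact: factor_block.
Qed.

End Weight.

(** * Balanced cocycles and the induced order on positions *)

Section BalancedCocycle.
Variables (S : nat -> nat -> nat) (l : nat -> nat).
Hypothesis SD : forall m n x, S (m + n) x = S m x + S n (x + m).
Hypothesis Sl : forall n x, l n <= S n x <= (l n).+1.
Hypothesis light_io : forall n N, exists2 x, N <= x & S n x = l n.
Hypothesis heavy_io : forall n N, 0 < n -> exists2 x, N <= x & S n x = (l n).+1.

Lemma light_or_heavy n x : S n x = l n \/ S n x = (l n).+1.
Proof. by have := Sl n x; lia. Qed.

(** The circle order of the rotation, read off the block counts. *)
Definition below x y := forall k, S k x <= S k y.

(** If lengths [k < k'] compared [x] and [y] in opposite ways, the blocks of length [k' - k] at
    [x + k] and [y + k] would differ by 2. *)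
Lemma below_total x y : below x y \/ below y x.
Proof.
apply: contrapT => /not_orP[/existsNP[k xy] /existsNP[k' yx]].
have [kk'|k'k] := leqP k k'.
  have := Sl (k' - k) (x + k); have := Sl (k' - k) (y + k).
  by have := SD k (k' - k) x; have := SD k (k' - k) y; rewrite subnKC //; lia.
have := Sl (k - k') (x + k'); have := Sl (k - k') (y + k').
have := SD k' (k - k') x; have := SD k' (k - k') y.
by rewrite (subnKC (ltnW k'k)); lia.
Qed.

(** Splitting the block of length [q + k] at [x] in two ways gives [S k (x + q) - S k x = S q (x +
    k) - S q x]. This exchange identity also drives the three lemmas that follow; the two converses
    take [x + k] light, resp. heavy. *)
Lemma light_below q x : S q x = l q -> below x (x + q).
Proof.
move=> Sq k; have := SD q k x; have := SD k q x; rewrite addnC.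
by have := Sl q (x + k); lia.
Qed.

Lemma heavy_below q x : S q x = (l q).+1 -> below (x + q) x.
Proof.
move=> Sq k; have := SD q k x; have := SD k q x; rewrite addnC.
by have := Sl q (x + k); lia.
Qed.

Lemma below_light q x : 0 < q -> below x (x + q) -> S q x = l q.
Proof.
move=> q0 xq; have [y xy Sy] := light_io q x.
have := xq (y - x); have := SD q (y - x) x; have := SD (y - x) q x.
by rewrite [q + _]addnC subnKC // Sy; have := Sl q x; lia.
Qed.

Lemma below_heavy q x : 0 < q -> below (x + q) x -> S q x = (l q).+1.
Proof.
move=> q0 qx; have [y xy Sy] := heavy_io x q0.
have := qx (y - x); have := SD q (y - x) x; have := SD (y - x) q x.
by rewrite [q + _]addnC subnKC // Sy; have := Sl q x; lia.
Qed.

Lemma light_down n x y : below x y -> S n y = l n -> S n x = l n.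
Proof. by move=> /(_ n); have := Sl n x; lia. Qed.

(** Otherwise each residue class modulo [n] has at most one light position, against [light_io]. *)
Lemma light_pair n : 0 < n ->
  exists x t, S n x = l n /\ S n (x + t.+1 * n) = l n.
Proof.
move=> n0; apply: contrapT => no_pair.
have bound (r : 'I_n) : exists N, forall x,
    N <= x -> x %% n = r -> S n x = (l n).+1.
  case: (EM (exists2 x, x %% n = r & S n x = l n)) => [[x xr Sx]|no_x].
    exists x.+1 => y xy yr; case: (light_or_heavy n y) => // Sy; case: no_pair.
    exists x, ((y - x) %/ n).-1; split=> //; suff <- : y = x + ((y - x) %/ n).-1.+1 * n by [].
    have dvd : n %| y - x by rewrite -eqn_mod_dvd 1?ltnW // xr yr.
    rewrite prednK ?divnK //; first by lia.
    by rewrite divn_gt0 // dvdn_leq //; lia.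
  exists 0 => y _ yr; case: (light_or_heavy n y) => // Sy.
  by case: no_x; exists y.
have [N bN] := choice bound.
have [x Nx Sx] := light_io n (\max_(r < n) N r).
have := bN (Ordinal (ltn_pmod x n0)) x; rewrite Sx => H.
suff : l n = (l n).+1 by lia.
by apply: H => //; apply: leq_trans Nx; exact: leq_bigmax.
Qed.

(** Otherwise [l] gains at least [l n + 1] at each step of [n], so a run of blocks of length [n] has
    at most one light block in excess of what this growth allows; a run starting and ending with
    distinct light blocks contradicts it. *)
Lemma exists_additive n : exists2 q, 0 < q & l (q + n) = l q + l n.
Proof.
case: (posnP n) => [->|n0].
  exists 1 => //; rewrite addn0; have [x _ Sx] := light_io 0 0.
  by have := SD 0 0 x; rewrite !addn0 Sx; lia.
apply: contrapT => no_q.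
have superD q : 0 < q -> l q + l n < l (q + n).
  move=> q0; have [x _ Sx] := light_io (q + n) 0.
  have := Sl q x; have := Sl n (x + q); have := SD q n x.
  suff : l (q + n) <> l q + l n by lia.
  by move=> eq_l; apply: no_q; exists q.
have superM t : t.+1 * (l n).+1 <= (l (t.+1 * n)).+1.
  elim: t => [|t IH]; first by rewrite !mul1n.
  have := superD (t.+1 * n) ltac:(by rewrite muln_gt0 n0).
  by rewrite (mulSnr t.+1 n); lia.
have [x [t [Sx Sxt]]] := light_pair n0.
have Sbound s : S (s.+1 * n) x < s.+1 * (l n).+1.
  elim: s => [|s IH]; first by rewrite !mul1n Sx.
  by rewrite (mulSnr s.+1 n) SD; have := Sl n (x + s.+1 * n); lia.
have := Sbound t; have := superM t.+1; have := Sl (t.+2 * n) x.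
by rewrite (mulSnr t.+1 n) SD Sxt; lia.
Qed.


Lemma balance_pair_nested p q :
  (forall x, S p x = l p -> S q x = l q) \/
  (forall x, S q x = l q -> S p x = l p).
Proof.
apply: contrapT => /not_orP[/existsNP[x /not_implyP[px qx]]].
move=> /existsNP[y /not_implyP[qy py]].
have := Sl p y; have := Sl q x.
by case: (below_total x y) => [/(_ q)|/(_ p)]; lia.
Qed.

(** For [p < q] with the same light positions, the difference [S q - S p] is constant, so
    [S (q - p)] is eventually constant, although both its values recur. *)
Lemma light_inj p q : 0 < p -> 0 < q ->
  (forall x, S p x = l p <-> S q x = l q) -> p = q.
Proof.
wlog pq : p q / p < q => [wlg p0 q0 eq_light|_ _ eq_light].
  case: (ltngtP p q) => // pq; first exact: wlg.
  by apply/esym/wlg => // x; rewrite eq_light.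
have cst x : p <= x -> S (q - p) x + l p = l q.
  move=> px; have := SD p (q - p) (x - p).
  rewrite (subnKC (ltnW pq)) (subnK px); have := eq_light (x - p).
  by have := Sl p (x - p); have := Sl q (x - p); lia.
have [x px Sx] := light_io (q - p) p.
have [y py Sy] := heavy_io p (ltac:(lia) : 0 < q - p).
by have := cst x px; have := cst y py; lia.
Qed.

(* [right_move n q] and [left_move n q]: in rotation terms, translation by [q]
   moves some point of the interval of [n]-light points to the right, resp. to
   the left, inside that interval.  A left move of a point of the interval cannot
   leave it, as the interval is closed downwards for [below]. *)
Definition right_move n q := 0 < q /\
  exists x, [/\ S n x = l n, S q x = l q & S n (x + q) = l n].

Definition left_move n q := 0 < q /\
  exists x, S n x = l n /\ S q x = (l q).+1.

Definition least (P : nat -> Prop) q := P q /\ forall r, P r -> q <= r.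

Lemma exists_least (P : nat -> Prop) : (exists q, P q) -> exists q, least P q.
Proof.
move=> exP; have exPb : exists q, `[< P q >].
  by case: exP => q Pq; exists q; apply/asboolP.
by case: (ex_minnP exPb) => q /asboolP Pq minq; exists q; split=> // r /asboolP /minq.
Qed.

(** For an additive [q], a light block of length [q + n] splits into light blocks in both orders,
    [q] then [n] and [n] then [q]. *)
Lemma exists_right_move n : exists q, right_move n q.
Proof.
have [q q0 eq_l] := exists_additive n; exists q; split=> //.
have [x _ Sx] := light_io (q + n) 0; exists x.
have := Sl q x; have := Sl n (x + q); have := SD q n x.
have := Sl n x; have := Sl q (x + n); have := SD n q x.
by rewrite [n + q]addnC => *; split; lia.
Qed.

(** Without left moves, all [n]-light positions are minimal for [below]; the step between two of
    them would be both light and heavy. *)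
Lemma exists_left_move n : exists q, left_move n q.
Proof.
have [x _ Sx] := light_io n 0; have [y xy Sy] := light_io n x.+1.
have minimal z : S n z = l n -> (forall q, ~ left_move n q) -> forall k, S k z = l k.
  move=> Sz no_left k; case: (light_or_heavy k z) => // Skz.
  case: (posnP k) => [k0|k0]; last by case: (no_left k); split=> //; exists z.
  by have [u _] := light_io 0 0; have := SD 0 0 z; have := SD 0 0 u; rewrite k0 !addn0; lia.
apply: contrapT => /forallNP no_left.
have Sk k : S k x = S k y by rewrite (minimal x) // (minimal y).
have yE : y = x + (y - x) by lia.
have := @below_light (y - x) x ltac:(lia) ltac:(by move=> k; rewrite -yE Sk).
have := @below_heavy (y - x) x ltac:(lia) ltac:(by move=> k; rewrite -yE Sk).
by lia.
Qed.

(** An earlier return at [x + r] yields a shorter right move: [r] itself if it goes up from [x],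
    else [q - r] from [x + r] to [x + q]. The left case is symmetric. *)
Lemma right_first_return n q x r :
  least (right_move n) q -> S n x = l n -> S q x = l q -> S n (x + q) = l n ->
  0 < r < q -> S n (x + r) <> l n.
Proof.
move=> [_ minq] Sx Sqx Sxq /andP[r0 rq] Sxr.
have [Srx|Srx] := light_or_heavy r x.
  by have : q <= r; [apply: minq; split=> //; exists x | lia].
have xrq : x + r + (q - r) = x + q by lia.
have Sqr : S (q - r) (x + r) = l (q - r).
  apply: below_light => [|k]; first by lia.
  by rewrite xrq; apply: leq_trans (light_below Sqx k); exact: heavy_below.
suff : q <= q - r by lia.
by apply: minq; split; [lia | exists (x + r); rewrite xrq].
Qed.

Lemma left_first_return n q x r :
  least (left_move n) q -> S n x = l n -> S q x = (l q).+1 ->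
  0 < r < q -> S n (x + r) <> l n.
Proof.
move=> [_ minq] Sx Sqx /andP[r0 rq] Sxr.
have [Srx|Srx] := light_or_heavy r x; last first.
  by have : q <= r; [apply: minq; split=> //; exists x | lia].
have xrq : x + r + (q - r) = x + q by lia.
have Sqr : S (q - r) (x + r) = (l (q - r)).+1.
  apply: below_heavy => [|k]; first by lia.
  by rewrite xrq; apply: leq_trans (light_below Srx k); exact: heavy_below.
suff : q <= q - r by lia.
by apply: minq; split; [lia | exists (x + r)].
Qed.

Lemma left_move_return n q x :
  S n x = l n -> S q x = (l q).+1 -> S n (x + q) = l n.
Proof. by move=> Sx Sqx; apply: light_down Sx; exact: heavy_below. Qed.

Definition two_moves n q1 q2 := forall x, S n x = l n ->
  S q2 x = (l q2).+1 \/ (S q1 x = l q1 /\ S n (x + q1) = l n).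

Lemma constant_two_moves n q1 q2 :
  least (right_move n) q1 -> least (left_move n) q2 ->
  (forall k x y, k <= n -> S n x = l n -> S n y = l n -> S k x = S k y) ->
  two_moves n q1 q2.
Proof.
move=> [[q10 [z [Sz Sq1z Szq1]]] minq1] [[q20 [y [Sy Sq2y]]] minq2] cst x Sx.
have [Sq2x|Sq2x] := light_or_heavy q2 x; [right | by left].
have light_n k u : k <= n -> S n u = l n -> S k u = l k.
  move=> kn Su; have [t _ St] := light_io k 0.
  case: (below_total u t) => [/(light_down)|/(light_down)]; first exact.
  by move=> /(_ _ Su) Snt; rewrite (cst _ u t).
have nq2 : n < q2 by rewrite ltnNge; apply/negP => /light_n/(_ Sy); lia.
have light_q2 k u : k < q2 -> S n u = l n -> S k u = l k.
  move=> kq2 Su; have [//|Sku] := light_or_heavy k u.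
  case: (posnP k) => [k0|k0]; first by apply: light_n => //; lia.
  by have : q2 <= k; [apply: minq2; split=> //; exists u | lia].
(* This [p] turns out to be a right move from [x], so [q1 <= p]; if [q1 < p], then [q1 + n < q2] is
   light on all of J, which forces [x + q1] into J. *)
set p := q2 - n; have q2E : q2 = n + p by lia.
have lp : l q2 = l n + l p.
  have := SD n p x; have := SD n p y; rewrite -q2E.
  by have := Sl p (x + n); have := Sl p (y + n); lia.
have Spx : S p x = l p.
  case: (ltnP p q2) => [pq2|]; first exact: light_q2.
  by move=> q2p; have -> : p = q2 by lia.
have Sxp : S n (x + p) = l n.
  by have := SD p n x; rewrite addnC -q2E; lia.
have q1p : q1 <= p by apply: minq1; split; [lia | exists x].
move: q1p; rewrite leq_eqVlt => /predU1P[-> // | q1p].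
have Sq1x : S q1 x = l q1 by apply: light_q2 => //; lia.
have Sq1n u : S n u = l n -> S (q1 + n) u = l (q1 + n) by apply: light_q2; lia.
split=> //; have := Sq1n x Sx; have := Sq1n z Sz; rewrite !SD; lia.
Qed.

Lemma two_moves_constant n q1 q2 :
  least (right_move n) q1 -> least (left_move n) q2 -> two_moves n q1 q2 ->
  forall k x y, k <= n -> S n x = l n -> S n y = l n -> S k x = S k y.
Proof.
move=> least1 least2 two k x y kn Sx Sy; apply: contrapT => neq_S.
have [[q10 [z [Sz Sq1z Szq1]]] minq1] := least1.
have [[q20 [u [Su Sq2u]]] minq2] := least2.
have k0 : 0 < k.
  by case: (posnP k) neq_S => // ->; have := SD 0 0 x; have := SD 0 0 y; rewrite !addn0; lia.
have q2n : q2 < n.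
  have : k <> n by move=> kE; apply: neq_S; rewrite kE Sx Sy.
  suff : q2 <= k by lia.
  apply: minq2; split=> //; have [Skx|Skx] := light_or_heavy k x; last by exists x.
  by exists y; split=> //; have := Sl k y; lia.
(* The [q2]-light positions lie below [u], a point of J that is [q2]-heavy. *)
have light_q2 t : S q2 t = l q2 -> S n t = l n.
  move=> St; case: (below_total t u) => [/light_down|/(_ q2)]; [exact | lia].
have light_q2E t : S q2 t = l q2 <-> S q1 t = l q1 /\ S n (t + q1) = l n.
  split=> [Sq2t|[Sq1t Stq1]]; first by have [|//] := two t (light_q2 t Sq2t); lia.
  have St : S n t = l n := light_down (light_below Sq1t) Stq1.
  have [//|Sq2t] := light_or_heavy q2 t.
  have [q12|q21|q12] := ltngtP q1 q2; last by rewrite -q12.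
    by have := left_first_return least2 St Sq2t (r := q1); rewrite q10 q12 => /(_ isT).
  have := right_first_return least1 St Sq1t Stq1 (r := q2).
  by rewrite q20 q21 (left_move_return St Sq2t) => /(_ isT).
(* If [q1 = q2], every move by [q2] would land in J, whereas some [n]-heavy position [t] has a
   predecessor [t - q2]. *)
have q12 : q1 <> q2.
  move=> q12; have [t q2t St] := heavy_io q2 (ltac:(lia) : 0 < n).
  suff : S n (t - q2 + q2) = l n by rewrite subnK //; lia.
  have [/light_q2E[_]|Sq2t] := light_or_heavy q2 (t - q2); first by rewrite q12.
  have [s _ Ss] := light_io q2 0; have [_] := (light_q2E s).1 Ss; rewrite q12.
  have := SD q2 n s; have := SD q2 n (t - q2).
  by have := Sl (q2 + n) s; have := Sl (q2 + n) (t - q2); have := Sl n (t - q2 + q2); lia.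
have eq_l : l (q1 + n) = l q1 + l n.
  have [s _ Ss] := light_io (q1 + n) 0; have := SD q1 n s; have := SD q1 n z.
  have := Sl q1 s; have := Sl n (s + q1); have := Sl (q1 + n) z; lia.
have light_q2E' t : S q2 t = l q2 <-> S q1 t = l q1 /\ S (q1 + n) t = l (q1 + n).
  by rewrite light_q2E SD eq_l; split=> -[Sq1t]; lia.
(* The [q2]-light set is the intersection of two nested light sets, hence one of them; so [q2] is
   [q1] or [q1 + n], and the latter contradicts [q2 < n]. *)
case: (balance_pair_nested q1 (q1 + n)) => nested.
  apply: q12; apply: light_inj => // t; rewrite light_q2E'; split=> [Sq1t|[]//].
  by split=> //; exact: nested.
suff : q2 = q1 + n by lia.
apply: light_inj => // [|t]; first by lia.
by rewrite light_q2E'; split=> [[]//|Snt]; split=> //; exact: nested.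
Qed.

End BalancedCocycle.

(** * The letter count of a Sturmian word as a balanced cocycle *)

Section SturmianCocycle.
Variables (w : infword bool) (a : bool).
Hypothesis hw : sturmian w.

(** When a window of length [n] slides with constant weight, the entering letter equals the leaving
    one, so [n] is a period. *)
Lemma weight_not_eventually_constant n N c :
  0 < n -> ~ (forall x, N <= x -> weight w a n x = c).
Proof.
move=> n0 cst; apply: (sturmian_not_eventually_periodic hw n0 (N := N)) => x Nx.
have := weightS w a n x; rewrite weightSr !cst //; last by lia.
by case: (w x) (w (x + n)) (a) => -[] [] //=; lia.
Qed.

Lemma sturmian_cocycle : exists l : nat -> nat,
  [/\ forall n x, l n <= weight w a n x <= (l n).+1,
      forall n N, exists2 x, N <= x & weight w a n x = l n &
      forall n N, 0 < n -> exists2 x, N <= x & weight w a n x = (l n).+1].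
Proof.
have min_weight n : exists m, (exists x, weight w a n x = m) /\
    forall x, m <= weight w a n x.
  have [m [[x Sx] minm]] : exists m, least (fun m => exists x, weight w a n x = m) m.
    by apply: exists_least; exists (weight w a n 0), 0.
  by exists m; split=> [|y]; [exists x | apply: minm; exists y].
have [l lP] := choice min_weight.
have bound n x : l n <= weight w a n x <= (l n).+1.
  by have [[y eq_y] minl] := lP n; rewrite minl -eq_y sturmian_balanced.
exists l; split=> // n N.
  case: (posnP n) => [->|n0].
    by exists N => //; have := bound 0 N; rewrite /weight /=; lia.
  apply: contrapT => no_light.
  apply: (@weight_not_eventually_constant n N (l n).+1 n0) => x Nx.
  suff : weight w a n x <> l n by have := bound n x; lia.
  by move=> Sx; apply: no_light; exists x.
move=> n0; apply: contrapT => no_heavy.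
apply: (@weight_not_eventually_constant n N (l n) n0) => x Nx.
suff : weight w a n x <> (l n).+1 by have := bound n x; lia.
by move=> Sx; apply: no_heavy; exists x.
Qed.

End SturmianCocycle.

(** * Abelian classes of binary words and sets of two elements *)

Lemma count_mem_bool (a : bool) u : count_mem a u + count_mem (~~ a) u = size u.
Proof.
rewrite -(count_predC (pred1 a) u); congr addn.
by apply: eq_count => b /=; case: (a) b => -[].
Qed.

Lemma abelian_equivE (a : bool) u v :
  abelian_equiv u v <-> size u = size v /\ count_mem a u = count_mem a v.
Proof.
have := count_mem_bool a u; have := count_mem_bool a v => sv su.
split=> [uv|[eq_size eq_a] b]; first by have := uv a; have := uv (~~ a); lia.
have [->//|->] : b = a \/ b = ~~ a by case: (a) (b) => -[]; auto.
by lia.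
Qed.

Lemma abelian_class_eq (a : bool) u v :
  abelian_class u = abelian_class v <->
  size u = size v /\ count_mem a u = count_mem a v.
Proof.
rewrite -abelian_equivE; split=> [eq_uv|uv].
  have : abelian_class v v by move=> b.
  by rewrite -eq_uv.
by apply/seteqP; split=> t ut b; rewrite -ut uv.
Qed.

Lemma card_eq2P (T : Type) (A : set T) :
  A #= `I_2 <-> exists x y, x <> y /\ A = [set x; y].
Proof.
split=> [/eq_cardSP[x Ax /eq_cardSP[y [Ay yx]]]|[x [y [xy ->]]]].
  rewrite II0 card_eq0 => /eqP AE; exists x, y; split; first by move=> xy; apply: yx.
  apply/seteqP; split=> [z Az|z [->|->] //].
  apply: contrapT => /not_orP[zx zy].
  by have : (A `\ x `\ y) z by []; rewrite AE.
apply/eq_cardSP; exists x; first by left.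
rewrite (_ : _ `\ x = [set y]) ?card_set1 //.
apply/seteqP; split=> [z [[|->//]] //|z ->]; split; first by right.
by move=> yx; apply: xy.
Qed.

(** * Abelian returns as moves, singularity as constancy *)

Section Returns.
Variables (w : infword bool) (v : seq bool) (a : bool) (l : nat -> nat).
Hypothesis weight_l : forall n x, l n <= weight w a n x <= (l n).+1.
Hypothesis light_io : forall n N, exists2 x, N <= x & weight w a n x = l n.
Hypothesis heavy_io :
  forall n N, 0 < n -> exists2 x, N <= x & weight w a n x = (l n).+1.
Hypothesis v_light : count_mem a v = l (size v).

Let n := size v.
Let S := weight w a.

Lemma abelian_occE i : abelian_occ w v i <-> S n i = l n.
Proof.
rewrite /abelian_occ (abelian_equivE a) size_block -v_light.
by split=> [[]|].
Qed.

Lemma abelian_class_block i j p q :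
  abelian_class (block w i p) = abelian_class (block w j q) <->
  p = q /\ S p i = S q j.
Proof. by rewrite (abelian_class_eq a) !size_block. Qed.

Lemma consecutive_occP i j : consecutive_occ w v i j <->
  [/\ i < j, S n i = l n, S n j = l n &
      forall r, 0 < r < j - i -> S n (i + r) <> l n].
Proof.
split=> -[ij] => [/abelian_occE Si /abelian_occE Sj next|Si Sj next]; split=> //.
- by move=> r r_bd /abelian_occE; apply: next; lia.
- exact/abelian_occE.
- exact/abelian_occE.
move=> k k_bd /abelian_occE; have -> : k = i + (k - i) by lia.
by apply: next; lia.
Qed.

Lemma next_occurrence i : S n i = l n -> exists j, consecutive_occ w v i j.
Proof.
move=> Si; have [r [[r0 Sr] minr]] :
    exists r, least (fun r => 0 < r /\ S n (i + r) = l n) r.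
  apply: exists_least; have [x ix Sx] := light_io n i.+1.
  by exists (x - i); split; [lia | rewrite subnKC // ltnW].
exists (i + r); apply/consecutive_occP; split=> //; first by lia.
move=> t t_bd St; suff : r <= t by lia.
by apply: minr; split=> //; lia.
Qed.

Lemma abelian_returns_two_moves q1 q2 :
  least (right_move S l n) q1 -> least (left_move S l n) q2 ->
  abelian_returns w v #= `I_2 <-> two_moves S l n q1 q2.
Proof.
move=> least1 least2.
have [[q10 [x1 [Sx1 Sq1x1 Sx1q1]]] _] := least1.
have [[q20 [x2 [Sx2 Sq2x2]]] _] := least2.
have SD := weightD w a.
set C1 := abelian_class (block w x1 q1); set C2 := abelian_class (block w x2 q2).
(* Even at equal lengths the classes differ, one block being light and the other heavy. *)
have C12 : C1 <> C2.
  by move=> /abelian_class_block[q12]; rewrite Sq1x1 Sq2x2 q12; lia.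
have returnsC1 : abelian_returns w v C1.
  exists x1, (x1 + q1); rewrite addKn; split=> //; apply/consecutive_occP.
  split=> //; rewrite ?addKn; first by lia.
  by move=> r; apply: (right_first_return SD weight_l light_io).
have returnsC2 : abelian_returns w v C2.
  exists x2, (x2 + q2); rewrite addKn; split=> //; apply/consecutive_occP.
  split=> //; rewrite ?addKn; first by lia.
    exact: (left_move_return SD weight_l).
  by move=> r; apply: (left_first_return SD weight_l heavy_io).
have -> : (abelian_returns w v #= `I_2) <-> abelian_returns w v `<=` [set C1; C2].
  rewrite card_eq2P; split=> [[D1 [D2 [_ defD]]]|sub].
    move: returnsC1 returnsC2 C12; rewrite defD.
    by case=> -> [] -> // _; rewrite setUC.
  by exists C1, C2; split=> //; apply/seteqP; split=> // _ [->|->].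
split=> [sub x Sx|two C [i [j [/consecutive_occP[ij Si Sj next] ->]]]].
  have [j xj] := next_occurrence Sx; have [ltxj _ Sj _] := (consecutive_occP _ _).1 xj.
  have : abelian_returns w v (abelian_class (block w x (j - x))) by exists x, j.
  (* The class of a return determines its length and weight, hence which move it is. *)
  move=> /sub[|] /abelian_class_block[eq_q Sxj]; [right | left].
    by rewrite -{1 3}eq_q Sxj Sq1x1 (subnKC (ltnW ltxj)).
  by rewrite -{1}eq_q Sxj Sq2x2.
have [Sq2i|[Sq1i Siq1]] := two i Si.
  right; apply/abelian_class_block; suff -> : j - i = q2 by rewrite Sq2x2.
  case: (ltngtP (j - i) q2) => // lt.
    have /(_ ltac:(lia)) := left_first_return SD weight_l heavy_io least2 Si Sq2i (r := j - i).
    by rewrite (subnKC (ltnW ij)).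
  by have /(_ (left_move_return SD weight_l Si Sq2i)) := next q2 ltac:(lia).
left; apply/abelian_class_block; suff -> : j - i = q1 by rewrite Sq1x1.
case: (ltngtP (j - i) q1) => // lt.
  have /(_ ltac:(lia)) :=
    right_first_return SD weight_l light_io least1 Si Sq1i Siq1 (r := j - i).
  by rewrite (subnKC (ltnW ij)).
by have := next q1 ltac:(lia).
Qed.

(** A binary word is recovered from its prefix weights, whose successive differences tell its
    letters. *)
Lemma singular_constant : factor w v -> singular w v <->
  (forall k x y, k <= n -> S n x = l n -> S n y = l n -> S k x = S k y).
Proof.
move=> fv; split=> [[_ sing] k x y kn /abelian_occE Sx /abelian_occE Sy|cst].
  have eq_v i : abelian_occ w v i -> block w i n = v.
    by apply: sing; exact: factor_block.
  have : block w x n = block w y n by rewrite !eq_v.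
  rewrite -(subnKC kn) !block_cat => /(congr1 (take k)).
  by rewrite !take_size_cat ?size_block // /S /weight => ->.
split=> // u /factorP[i eq_u] /(abelian_equivE a)[size_u].
have [j eq_v] := factorP fv.
rewrite v_light eq_u size_u => Si; have Sj : S n j = l n by rewrite /S /weight -eq_v.
rewrite [RHS]eq_v; apply: eq_block => k kn.
have := cst k.+1 i j kn Si Sj; have := cst k i j (ltnW kn) Si Sj.
rewrite /S !weightSr; move: (weight w a k i) (weight w a k j) => s t -> /addnI.
by case: (w (i + k)) (w (j + k)) (a) => -[] [].
Qed.

End Returns.

Theorem theorem16 (w : infword bool) (v : seq bool)
    (hw : sturmian w) (hv : factor w v) :
  abelian_returns w v #= `I_2 <-> singular w v.
Proof.
have [i eq_v] := factorP hv.
(* If neither letter worked, one block would have fewer [true] than [v] and another more, a gap of 2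
   against balance. *)
have [a v_min] : exists a, forall x, count_mem a v <= weight w a (size v) x.
  apply: contrapT => /forallNP no_min.
  have /existsNP[x v_x] := no_min true; have /existsNP[y v_y] := no_min false.
  have := sturmian_balanced true (size v) x y hw; move: v_x v_y.
  have := count_mem_bool true (block w x (size v)).
  have := count_mem_bool true (block w y (size v)); have := count_mem_bool true v.
  by rewrite !size_block /weight /=; lia.
have [l [weight_l light_io heavy_io]] := sturmian_cocycle a hw.
have v_light : count_mem a v = l (size v).
  have [x _ Sx] := light_io (size v) 0; have := v_min x.
  by have := weight_l (size v) i; rewrite Sx /weight -eq_v; lia.
have SD := weightD w a.
have [q1 least1] := exists_least (exists_right_move SD weight_l light_io (size v)).
have [q2 least2] :=
  exists_least (exists_left_move SD weight_l light_io heavy_io (size v)).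
rewrite (abelian_returns_two_moves weight_l light_io heavy_io v_light least1 least2).
rewrite (singular_constant v_light hv); split.
  exact: (two_moves_constant SD weight_l light_io heavy_io least1 least2).
exact: (constant_two_moves SD weight_l light_io least1 least2).
Qed.
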